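(* Let $V$ be a DVR with quotient field $K$ and perfect residue field, and let $\alpha\in\mathbb{K}$ be transcendental over $K$. The following conditions are equivalent. (1) $\alpha\in\mathbb{K}^{\mathrm{br}}$, i.e. $e_\alpha<\infty$. (2) $V_{\alpha}$ is a DVR. (3) There exists a Cauchy sequence $\{s_n\}_{n\in\mathbb{N}}\subset\overline{\widehat K}$ converging to $\alpha$ and with $\{e_{s_n}\}_{n\in\mathbb{N}}$ bounded. Moreover, the implication $(3)\Rightarrow(2)$ holds without the hypothesis that the residue field of $V$ be perfect.
   Context: A DVR is a discrete valuation domain of rank one (value group isomorphic to $\mathbb{Z}$). $V$ is a DVR with quotient field $K$, associated valuation $v$ and value group $\Gamma_v$; $X$ is an indeterminate over $K$. $\widehat K$ is the $v$-adic completion of $K$, $\overline{\widehat K}$ an algebraic closure of $\widehat K$, and $v$ also denotes its unique extension to $\overline{\widehat K}$; $\mathbb{K}$ is the completion of $\overline{\widehat K}$ with respect to $v$, with the extended valuation again denoted $v$. For $\alpha\in\mathbb{K}$ transcendental over $K$, put $V_\alpha=\{\phi\in K(X)\mid v(\phi(\alpha))\ge 0\}$, a valuation domain of $K(X)$. For $s\in\mathbb{K}$, $e_s=e(\widehat K(s)\mid\widehat K)$ is the ramification index, i.e. the index of $v(\widehat K^\times)=\Gamma_v$ in $v(\widehat K(s)^\times)$, an element of $\mathbb{N}\cup\{\infty\}$. Put $\mathbb{K}^{\mathrm{br}}=\{\alpha\in\mathbb{K}\mid e_\alpha<\infty\}$. *)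

(* Defs.v *)
From HB Require Import structures.
From mathcomp Require Import all_boot all_order all_algebra all_field.
From mathcomp Require Import boolp classical_sets cardinality.
From mathcomp Require Import constructive_ereal.
From mathcomp Require Import finmap.

Set Implicit Arguments.
Unset Strict Implicit.
Unset Printing Implicit Defensive.

Import Order.TTheory GRing.Theory Num.Theory.
Local Open Scope classical_set_scope.
Local Open Scope ring_scope.

(* Additive valuations with v 0 = +oo.  The value group of a normalized
   discrete valuation on F lies in int.  Every extension of a discrete
   valuation to an algebraic extension, and to a completion thereof, has its
   value group in the divisible hull of Z, that is in rat. *)
Record valuation (F : fieldType) (R : realDomainType) := Valuation {
  valuation_fun :> F -> \bar R;
  valuation_neqNy : forall x, valuation_fun x <> -oo%E;
  valuation_eqy : forall x, valuation_fun x = +oo%E <-> x = 0;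
  valuationM : forall x y,
    valuation_fun (x * y) = (valuation_fun x + valuation_fun y)%E;
  valuationD : forall x y,
    (mine (valuation_fun x) (valuation_fun y) <= valuation_fun (x + y))%E
}.

Definition valuation_ring (F : fieldType) (R : realDomainType)
    (v : valuation F R) : set F :=
  [set x | (0 <= v x)%E].

(* v(L^x); the condition v x = r%:E forces x != 0. *)
Definition value_group (F : fieldType) (R : realDomainType)
    (v : valuation F R) (L : set F) : set R :=
  [set r | exists2 x, L x & v x = r%:E].

(* A is a DVR with quotient field F. *)
Definition is_DVR (F : fieldType) (A : set F) : Prop :=
  exists2 w : valuation F int,
    value_group w [set: F] = [set: int] & A = valuation_ring w.

(* k is the residue field of v, with residue map res; the values of res
   outside the valuation ring are irrelevant. *)
Record is_residue_map (F : fieldType) (R : realDomainType)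
    (v : valuation F R) (k : fieldType) (res : F -> k) : Prop := {
  residue_map1 : res 1 = 1;
  residue_mapD : forall x y, valuation_ring v x -> valuation_ring v y ->
    res (x + y) = res x + res y;
  residue_mapM : forall x y, valuation_ring v x -> valuation_ring v y ->
    res (x * y) = res x * res y;
  residue_map_surj : forall c, exists2 x, valuation_ring v x & res x = c;
  residue_map_ker : forall x, valuation_ring v x ->
    (res x = 0 <-> (0 < v x)%E)
}.

Definition perfect_field (k : fieldType) : Prop :=
  forall p : {poly k}, irreducible_poly p -> separable_poly p.

Definition cauchy_for (F : fieldType) (v : valuation F rat) (s : nat -> F)
    : Prop :=
  forall M : rat, exists N : nat, forall m n : nat,
    (N <= m)%N -> (N <= n)%N -> (M%:E <= v (s m - s n)%R)%E.

Definition converges_for (F : fieldType) (v : valuation F rat) (s : nat -> F)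
    (a : F) : Prop :=
  forall M : rat, exists N : nat, forall n : nat,
    (N <= n)%N -> (M%:E <= v (s n - a)%R)%E.

Definition extends (F G : fieldType) (f : {rmorphism F -> G})
    (v : valuation F rat) (w : valuation G rat) : Prop :=
  forall x, w (f x) = v x.

Record is_completion (F G : fieldType) (f : {rmorphism F -> G})
    (v : valuation F rat) (w : valuation G rat) : Prop := {
  completion_extends : extends f v w;
  completion_dense : forall (y : G) (M : rat),
    exists x : F, (M%:E <= w (y - f x)%R)%E;
  completion_complete : forall s : nat -> G,
    cauchy_for w s -> exists a, converges_for w s a
}.

(* phi(a); independent of the chosen representative of phi when a is
   transcendental over F, since no denominator then vanishes at a. *)
Definition ratfun_eval (F G : fieldType) (f : {rmorphism F -> G}) (a : G)
    (phi : {fraction {poly F}}) : G :=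
  (map_poly f \n_(repr phi)).[a] / (map_poly f \d_(repr phi)).[a].

(* V_a, as a subset of F(X) *)
Definition valuation_ring_at (F G : fieldType) (f : {rmorphism F -> G})
    (w : valuation G rat) (a : G) : set {fraction {poly F}} :=
  [set phi | (0 <= w (ratfun_eval f a phi))%E].

(* The subfield F(s) of G. *)
Definition adjoin_field (F G : fieldType) (f : {rmorphism F -> G}) (s : G)
    : set G :=
  [set y | exists p q : {poly F},
     (map_poly f q).[s] <> 0 /\ y = (map_poly f p).[s] / (map_poly f q).[s]].

Definition cosets (T : zmodType) (A B : set T) : set (set T) :=
  [set [set g + h | h in B] | g in A].

(* The index (A : B) in N union {+oo}. *)
Definition group_index (T : zmodType) (A B : set T) : \bar int :=
  if `[< finite_set (cosets A B) >]
  then (Posz #|` fset_set (cosets A B)|)%:E else +oo%E.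

(* e(F(s) | F) *)
Definition ramification_index (F G : fieldType) (f : {rmorphism F -> G})
    (w : valuation G rat) (s : G) : \bar int :=
  group_index (value_group w (adjoin_field f s)) (value_group w (range f)).

(* Main.v *)
Require Import Defs.
From HB Require Import structures.
From mathcomp Require Import all_boot all_order all_algebra all_field ring.
From mathcomp Require Import boolp classical_sets cardinality.
From mathcomp Require Import constructive_ereal.

Set Implicit Arguments.
Unset Strict Implicit.
Unset Printing Implicit Defensive.

Import Order.TTheory GRing.Theory Num.Theory.
Local Open Scope classical_set_scope.
Local Open Scope ring_scope.

(** Write c for the least positive value on K, so that v(Khat^x) = cZ, and H
for the value group of Khat(alpha). The whole equivalence is a statement
about the subgroup H of Q: each condition says that H is discrete.

For cond2, approximating the coefficients of polynomials over Khat by elements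
of K does not move the value taken at alpha (value_group_adjoin_completion),
so H is also the value group of K(alpha), i.e. of the valuation of K(X) whose
ring is V_alpha; a valuation ring is a DVR exactly when its value group is
infinite cyclic (DVR_value_group, value_group_DVR). For cond1, the index of
cZ in a subgroup H of Q containing it is finite exactly when H has bounded
torsion modulo cZ, that is, when H is cyclic (group_index_torsion, bounded_torsion_multiples,
group_index_multiples).

cond3 implies cond2: a polynomial nonzero at alpha has the same value at alpha
and at s_n for large n (horner_continuous), so every element of H lies in the
value group of some Khat(s_n), and the bound on e(s_n) bounds the torsion of
H modulo cZ.

cond2 implies cond3: for each M choose, among the algebraic elements s with
v(s - alpha) >= M, one of least degree over Khat. All roots z of a polynomial
p of smaller degree satisfy v(z - alpha) < M, hence v(s - z) = v(alpha - z),
and p takes the same value at s and at alpha. As every element of Khat(s) is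
a quotient of such polynomials in s, the value group of Khat(s) is contained
in H (minimal_pair), and e(s) is bounded by the index of cZ in H. *)

(** * Valuations *)

Section ValuationTheory.

Variables (F : fieldType) (R : realDomainType) (v : valuation F R).
Implicit Types x y : F.

Lemma valuation0 : v 0 = +oo%E.
Proof. exact/valuation_eqy. Qed.

Lemma valuation_fin x : x != 0 -> exists r, v x = r%:E.
Proof.
move=> x0; case E: (v x) => [r| |]; first by exists r.
  by move/valuation_eqy: E => /eqP; rewrite (negPf x0).
by case: (valuation_neqNy E).
Qed.

Lemma valuation_fin_neq0 x r : v x = r%:E -> x != 0.
Proof. by move=> E; apply/eqP => x0; move: E; rewrite x0 valuation0. Qed.

Lemma valuation1 : v 1 = 0%E.
Proof.
have [r E] := valuation_fin (oner_neq0 F).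
have := valuationM v 1 1; rewrite mulr1 E -EFinD => -[] /eqP.
by rewrite -[X in X == _]addr0 (inj_eq (addrI r)) => /eqP <-.
Qed.

Lemma valuationN1 : v (-1) = 0%E.
Proof.
have m1 : (-1 : F) != 0 by rewrite oppr_eq0 oner_neq0.
have [r E] := valuation_fin m1.
have := valuationM v (-1) (-1); rewrite mulrNN mulr1 valuation1 E -EFinD => -[].
by move/eqP; rewrite eq_sym -mulr2n mulrn_eq0 /= => /eqP ->.
Qed.

Lemma valuationN x : v (- x) = v x.
Proof. by rewrite -mulN1r valuationM valuationN1 add0e. Qed.

Lemma valuationV x r : v x = r%:E -> v x^-1 = (- r)%:E.
Proof.
move=> E; have x0 := valuation_fin_neq0 E.
have [s Es] := valuation_fin (invr_neq0 x0).
have := valuationM v x x^-1; rewrite divff // valuation1 E Es -EFinD => -[].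
by move/esym/eqP; rewrite addrC addr_eq0 => /eqP ->.
Qed.

Lemma valuationX x r n : v x = r%:E -> v (x ^+ n) = (r *+ n)%:E.
Proof.
move=> E; elim: n => [|n IHn]; first by rewrite expr0 valuation1 mulr0n.
by rewrite exprS valuationM IHn E -EFinD mulrS.
Qed.

Lemma valuationXz x r (z : int) : v x = r%:E -> v (x ^ z) = (r *~ z)%:E.
Proof.
move=> E; case: z => n; first exact: valuationX.
by rewrite NegzE -invr_expz -exprnP (valuationV (valuationX n.+1 E)) mulrNz.
Qed.

Lemma valuation_geD (M : \bar R) x y :
  (M <= v x -> M <= v y -> M <= v (x + y)%R)%E.
Proof.
move=> Mx My; apply: le_trans (valuationD v x y).
by rewrite le_min Mx My.
Qed.

Lemma valuation_geB (M : \bar R) x y :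
  (M <= v x -> M <= v y -> M <= v (x - y)%R)%E.
Proof. by move=> Mx My; apply: valuation_geD; rewrite ?valuationN. Qed.

Lemma valuation_distC x y : v (x - y) = v (y - x).
Proof. by rewrite -opprB valuationN. Qed.

(** Isosceles triangle principle. *)
Lemma valuation_eq_dist x y : (v x < v (y - x)%R -> v y = v x)%E.
Proof.
move=> lt_x; apply/eqP; rewrite eq_le; apply/andP; split; last first.
  by rewrite -[y](subrK x) valuation_geD // ltW.
rewrite leNgt; apply/negP => lt_xy.
have : (mine (v y) (v (y - x)%R) <= v x)%E.
  rewrite -[X in (_ <= v X)%E](subKr y x).
  by rewrite -[v (y - x)]valuationN valuationD.
by rewrite leNgt lt_min lt_xy lt_x.
Qed.

Lemma valuation_locally_constant x : x != 0 ->
  exists M : R, forall y, (M%:E <= v (y - x)%R)%E -> v y = v x.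
Proof.
move=> x0; have [r E] := valuation_fin x0; exists (r + 1) => y le_y.
apply: valuation_eq_dist; apply: lt_le_trans le_y.
by rewrite E lte_fin ltrDl ltr01.
Qed.

Lemma value_groupB (r s : R) :
  value_group v [set: F] r -> value_group v [set: F] s ->
  value_group v [set: F] (r - s).
Proof.
move=> [x _ Ex] [y _ Ey]; exists (x / y) => //.
by rewrite valuationM Ex (valuationV Ey).
Qed.

End ValuationTheory.

(** * Discrete subgroups of the value group *)

Definition multiples (T : zmodType) (c : T) : set T :=
  range (fun z : int => c *~ z).

Lemma multiplesB (T : zmodType) (c r s : T) :
  multiples c r -> multiples c s -> multiples c (r - s).
Proof. by move=> [z _ <-] [t _ <-]; exists (z - t) => //; rewrite mulrzBr. Qed.

(** Any two valuations with the same ring agree up to scaling; this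
compares [v] with the normalized valuation, at a uniformizer and hence
everywhere. *)
Lemma DVR_value_group (F : fieldType) (R : realDomainType) (v : valuation F R) :
  is_DVR (valuation_ring v) ->
  exists2 c : R, 0 < c & value_group v [set: F] = multiples c.
Proof.
move=> [w w_surj vw].
have vwE x : (0 <= v x)%E = (0 <= w x)%E.
  by apply/idP/idP => h; [have : valuation_ring w x by rewrite -vw
    | have : valuation_ring v x by rewrite vw].
have [p _ wp] : value_group w [set: F] (1 : int) by rewrite w_surj.
have [c vp] := valuation_fin v (valuation_fin_neq0 wp).
exists c.
  rewrite ltNge; apply/negP => c_le0.
  have : (0 <= w (p^-1)%R)%E by rewrite -vwE (valuationV vp) lee_fin oppr_ge0.
  by rewrite (valuationV wp).
(* [x] and [x^-1] both lie in the common ring. *)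
have v_unit x : w x = 0%E -> v x = 0%E.
  move=> wx; have [r vx] := valuation_fin v (valuation_fin_neq0 wx).
  have : (0 <= v x)%E by rewrite vwE wx.
  have : (0 <= v (x^-1)%R)%E by rewrite vwE (valuationV wx) oppr0.
  rewrite (valuationV vx) vx !lee_fin oppr_ge0 => r_le0 r_ge0.
  by congr _%:E; apply/eqP; rewrite eq_le r_le0 r_ge0.
have v_pow x z : w x = z%:E -> v x = (c *~ z)%:E.
  move=> wx; have x0 := valuation_fin_neq0 wx.
  have p0 := valuation_fin_neq0 wp.
  have -> : x = x * p ^ (- z) * p ^ z.
    by rewrite -mulrA -expfzDr // addNr expr0z mulr1.
  rewrite valuationM (valuationXz _ vp) v_unit ?add0e //.
  by rewrite valuationM wx (valuationXz _ wp) -EFinD intz subrr.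
apply/seteqP; split=> r.
  move=> [x _ vx].
  have [z wx] := valuation_fin w (valuation_fin_neq0 vx).
  by exists z => //; move: vx; rewrite (v_pow _ _ wx) => -[].
move=> [z _ <-]; exists (p ^ z) => //; exact: valuationXz.
Qed.

(** Dividing by the generator [c] of the value group and rounding turns [v]
into a normalized valuation; the floor only serves to land in [int], its
argument being an integer. *)
Lemma value_group_DVR (F : fieldType) (v : valuation F rat) (c : rat) :
  0 < c -> value_group v [set: F] = multiples c ->
  is_DVR (valuation_ring v).
Proof.
move=> c_gt0 Hv.
have cN0 : c != 0 by rewrite gt_eqF.
pose w x : \bar int := if v x is r%:E then (Num.floor (r / c))%:E else +oo%E.
have wE x z : v x = (c *~ z)%:E -> w x = z%:E.
  by move=> vx; rewrite /w vx mulrzAl divff // intrKfloor.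
have vP x : x != 0 -> exists2 z, v x = (c *~ z)%:E & w x = z%:E.
  move=> x0; have [r vx] := valuation_fin v x0.
  have [z _ Er] : multiples c r by rewrite -Hv; exists x.
  by exists z; [rewrite vx Er | apply: wE; rewrite vx Er].
have w0 : w 0 = +oo%E by rewrite /w valuation0.
have w_neqNy x : w x <> -oo%E by rewrite /w; case: (v x).
have w_eqy x : w x = +oo%E <-> x = 0.
  split=> [wx|->//]; apply/eqP/negPn/negP => x0.
  by have [z _] := vP _ x0; rewrite wx.
have wM x y : w (x * y) = (w x + w y)%E.
  have [->|x0] := eqVneq x 0.
    by rewrite mul0r w0; case: (w y) (@w_neqNy y).
  have [->|y0] := eqVneq y 0.
    by rewrite mulr0 w0; case: (w x) (@w_neqNy x).
  have [z vx ->] := vP _ x0; have [t vy ->] := vP _ y0.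
  by apply: wE; rewrite valuationM vx vy -EFinD mulrzDr.
have w_mono x y : (w x <= w y)%E = (v x <= v y)%E.
  have [->|y0] := eqVneq y 0; first by rewrite w0 valuation0 !leey.
  have [t vy wy] := vP _ y0.
  have [->|x0] := eqVneq x 0; first by rewrite w0 valuation0 vy wy.
  have [z vx wx] := vP _ x0.
  by rewrite vx wx vy wy !lee_fin ler_pMz2l.
have wD x y : (mine (w x) (w y) <= w (x + y)%R)%E.
  rewrite ge_min !w_mono -ge_min; exact: valuationD.
exists (Valuation w_neqNy w_eqy wM wD).
  apply/seteqP; split=> // z _.
  have [x _ vx] : value_group v [set: F] (c *~ z) by rewrite Hv; exists z.
  by exists x => //=; exact: wE.
apply/seteqP; split=> x; rewrite /valuation_ring /=.
  have [->|x0] := eqVneq x 0; first by rewrite w0 leey.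
  by have [z -> ->] := vP _ x0; rewrite !lee_fin -(mulr0z c) ler_pMz2l.
have [->|x0] := eqVneq x 0; first by rewrite valuation0 leey.
by have [z -> ->] := vP _ x0; rewrite !lee_fin -(mulr0z c) ler_pMz2l.
Qed.

Lemma subgroupMz (T : zmodType) (A : set T) (g : T) (z : int) :
  (forall r s, A r -> A s -> A (r - s)) -> A g -> A (g *~ z).
Proof.
move=> AB Ag.
have A0 : A 0 by rewrite -(subrr g); exact: AB.
have AN r : A r -> A (- r) by rewrite -[- r]add0r; exact: AB.
have AMn n : A (g *+ n).
  by elim: n => [//|n An]; have := AB _ _ An (AN _ Ag); rewrite opprK mulrSr.
by case: z => n; [exact: AMn | rewrite NegzE mulrNz; exact/AN/AMn].
Qed.

(** Euclidean division by the least positive multiple of [d] in [A]. *)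
Lemma subgroup_of_multiples (T : zmodType) (A : set T) (d : T) (N : nat) :
  (forall r s, A r -> A s -> A (r - s)) -> A `<=` multiples d ->
  (0 < N)%N -> A (d *+ N) ->
  exists2 n, (0 < n)%N & A = multiples (d *+ n).
Proof.
move=> AB Ad N0 AN.
have exP : exists n, (0 < n)%N && `[< A (d *+ n) >].
  by exists N; rewrite N0; exact/asboolP.
case: (ex_minnP exP) => n /andP[n0 /asboolP An] n_min; exists n => //.
apply/seteqP; split=> g; last by move=> [z _ <-]; exact: subgroupMz.
move=> Ag; have [z _ dz] := Ad _ Ag; exists (z %/ n)%Z => //.
have z_eq := divz_eq z n.
have dn : d *+ n *~ (z %/ n)%Z = d *~ ((z %/ n)%Z * n).
  by rewrite pmulrn -mulrzA mulrC.
have nz : (n : int) != 0 by rewrite eqz_nat -lt0n.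
have := modz_ge0 z nz; have := ltz_mod z nz.
case E: (z %% n)%Z => [r|//] r_lt _.
have gE : g = d *+ n *~ (z %/ n)%Z + d *+ r.
  by rewrite dn -dz {1}z_eq mulrzDr E.
have Ar : A (d *+ r).
  have -> : d *+ r = g - d *+ n *~ (z %/ n)%Z by rewrite gE addrC addKr.
  by apply: (AB _ _ Ag); exact: (subgroupMz _ AB An).
have [r0|r0] := posnP r.
  by rewrite gE r0 addr0.
have : (n <= r)%N by apply: n_min; rewrite r0; exact/asboolP.
by rewrite leqNgt -ltz_nat; move: r_lt; rewrite ltz_nat => ->.
Qed.

(** A torsion exponent [m] bounded by [k] divides [k`!], which confines [A]
to the multiples of [c / k`!]. *)
Lemma bounded_torsion_multiples (A : set rat) (c : rat) (k : nat) :
  0 < c -> (forall r s, A r -> A s -> A (r - s)) -> A c ->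
  (forall g, A g -> exists2 m, (0 < m <= k)%N & multiples c (g *+ m)) ->
  exists2 c', 0 < c' & A = multiples c'.
Proof.
move=> c0 AB Ac Ators.
have k0 : (k`!%:R : rat) != 0 by rewrite pnatr_eq0 -lt0n fact_gt0.
have cE : c / k`!%:R *+ k`! = c by rewrite -mulr_natr divfK.
have [|||n n0 ->] := @subgroup_of_multiples _ A (c / k`!%:R) k`! AB.
- move=> g /Ators[m m_k [z _ gE]]; have /dvdnP[q kE] := dvdn_fact m_k.
  exists (z * q) => //; apply: (mulIf k0).
  by rewrite mulrzAl divfK // mulrzA gE -pmulrn -mulrnA mulnC -kE mulr_natr.
- exact: fact_gt0.
- by rewrite cE.
exists (c / k`!%:R *+ n) => //.
by rewrite pmulrn_lgt0 // divr_gt0 // ltr0n fact_gt0.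
Qed.

Section GroupIndex.

Variables (T : zmodType) (A B : set T).

(** Pigeonhole: two of the [k.+1] cosets of [g *+ i], [i <= k], coincide. *)
Lemma group_index_torsion (k : nat) (g : T) :
  B 0 -> (forall r s, B r -> B s -> B (r - s)) ->
  (forall n, A (g *+ n)) -> (group_index A B <= (Posz k)%:E)%E ->
  exists2 m, (0 < m <= k)%N & B (g *+ m).
Proof.
move=> B0 BB Ag; rewrite /group_index; case: asboolP => // fin.
rewrite lee_fin lez_nat => card_k.
pose f (i : 'I_k.+1) := [set g *+ i + h | h in B].
have /injectivePn[x [y xy fxy]] : ~~ injectiveb f.
  apply/negP => f_inj.
  suff : (k.+1 <= k)%N by rewrite ltnn.
  apply: leq_trans card_k.
  rewrite -[k.+1]card_ord -(size_codom f).
  apply: uniq_leq_size f_inj _ => _ /codomP[x ->].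
  rewrite in_fset_set //; apply/mem_set; by exists (g *+ x).
wlog lt_xy : x y xy fxy / (x < y)%N => [wlog_lt|].
  have [lt|lt|/val_inj E] := ltngtP x y; first exact: (wlog_lt x y).
    by apply: (wlog_lt y x) => //; rewrite eq_sym.
  by rewrite E eqxx in xy.
exists (y - x)%N.
  by rewrite subn_gt0 lt_xy (leq_trans (leq_subr _ _)) // -ltnS.
have [h Bh hE] : f x (g *+ y) by rewrite fxy; exists 0; rewrite ?addr0.
by rewrite mulrnBr ?(ltnW lt_xy) // -hE addrC addKr.
Qed.

Lemma group_index_fin :
  (group_index A B < +oo)%E -> exists k, (group_index A B <= (Posz k)%:E)%E.
Proof.
by rewrite /group_index; case: asboolP => // _ _; eexists; exact: lexx.
Qed.

End GroupIndex.

(** Every coset of [d *+ N] met by [A] is that of [d *+ i] for some [i < N]. *)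
Lemma group_index_multiples (T : zmodType) (A : set T) (d : T) (N : nat) :
  (0 < N)%N -> A `<=` multiples d ->
  (group_index A (multiples (d *+ N)) <= (Posz N)%:E)%E.
Proof.
move=> N0 Ad; set B := multiples _.
pose f (i : nat) := [set d *+ i + h | h in B].
have sub : cosets A B `<=` [set f i | i in `I_N].
  move=> _ [g Ag <-]; have [z _ <-] := Ad _ Ag.
  have nz : (N : int) != 0 by rewrite eqz_nat -lt0n.
  have := modz_ge0 z nz; have := ltz_mod z nz.
  case E: (z %% N)%Z => [r|//]; rewrite ltz_nat => r_lt _.
  exists r => //; rewrite /f.
  have zE : d *~ z = d *+ r + d *+ N *~ (z %/ N)%Z.
    rewrite {1}(divz_eq z N) E mulrzDr addrC; congr (_ + _).
    by rewrite mulrC mulrzA.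
  apply/seteqP; split=> _ [_ [t _ <-] <-]; [exists (d *+ N *~ (t - (z %/ N)%Z))
    | exists (d *+ N *~ (t + (z %/ N)%Z))].
  - by exists (t - (z %/ N)%Z).
  - by rewrite zE mulrzBr -addrA; congr (_ + _); rewrite addrC subrK.
  - by exists (t + (z %/ N)%Z).
  - by rewrite zE -addrA -mulrzDr [t + _]addrC.
have fin : finite_set (cosets A B).
  by apply: sub_finite_set sub _; apply: finite_image; exact: finite_II.
rewrite /group_index asboolT // lee_fin lez_nat.
apply: geq_card_fset_set; apply: card_le_trans (subset_card_le sub) _.
exact: card_image_le.
Qed.

(** * Continuity of polynomial evaluation *)

Section Continuity.

Variables (F : fieldType) (R : realDomainType) (v : valuation F R).

Lemma scale_continuous (x : F) (M : R) : exists N : R,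
  forall y, (N%:E <= v y)%E -> (M%:E <= v (y * x)%R)%E.
Proof.
have [->|x0] := eqVneq x 0.
  by exists 0 => y _; rewrite mulr0 valuation0 leey.
have [r vx] := valuation_fin v x0; exists (M - r) => y Ny.
by rewrite valuationM vx -leeBlDr // -EFinB.
Qed.

Lemma mul_continuous (x y : F) (M : R) : exists N : R,
  forall x' y', (N%:E <= v (x' - x)%R)%E -> (N%:E <= v (y' - y)%R)%E ->
  (M%:E <= v (x' * y' - x * y)%R)%E.
Proof.
have [Nx HNx] := scale_continuous x M; have [Ny HNy] := scale_continuous y M.
(* The bounds by [M] and by [0] control [(x' - x) * (y' - y)]. *)
exists (Num.max (Num.max Nx Ny) (Num.max M 0)) => x' y'.
rewrite !EFin_max !ge_max => /andP[/andP[_ x_Ny] /andP[x_M _]].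
move=> /andP[/andP[y_Nx _] /andP[_ y_0]].
have -> : x' * y' - x * y = (x' - x) * (y' - y)
    + ((y' - y) * x + (x' - x) * y) by ring.
apply: valuation_geD; last by apply: valuation_geD; [exact: HNx|exact: HNy].
by rewrite valuationM -[leLHS]adde0 leeD.
Qed.

Lemma horner_continuous (p : {poly F}) (a : F) (M : R) : exists N : R,
  forall b, (N%:E <= v (b - a)%R)%E -> (M%:E <= v (p.[b] - p.[a])%R)%E.
Proof.
elim/poly_ind: p M => [|p c IHp] M.
  by exists 0 => b _; rewrite !horner0 subrr valuation0 leey.
have [N HN] := mul_continuous p.[a] a M; have [N' HN'] := IHp N.
exists (Num.max N N') => b; rewrite EFin_max ge_max => /andP[b_N b_N'].
by rewrite !hornerMXaddC opprD addrACA subrr addr0; apply: HN => //; exact: HN'.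
Qed.

End Continuity.

(** * Passing to the completion *)

Section Density.

Variables (F G : fieldType) (f : {rmorphism F -> G}).
Variables (v : valuation F rat) (w : valuation G rat).
Hypothesis fP : is_completion f v w.

Lemma completion_value_group :
  value_group w [set: G] = value_group v [set: F].
Proof.
apply/seteqP; split=> r [x _ xr].
  have [M HM] := valuation_locally_constant w (valuation_fin_neq0 xr).
  have [y xy] := completion_dense fP x M.
  exists y => //; rewrite -(completion_extends fP) HM //.
  by rewrite valuation_distC.
by exists (f x) => //; rewrite (completion_extends fP).
Qed.

Variables (E : fieldType) (g : {rmorphism G -> E}) (u : valuation E rat).
Hypothesis gP : extends g w u.

Lemma horner_dense (p : {poly G}) (a : E) (M : rat) : exists q : {poly F},
  (M%:E <= u ((map_poly (g \o f) q).[a] - (map_poly g p).[a])%R)%E.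
Proof.
elim/poly_ind: p M => [|p c IHp] M.
  by exists 0; rewrite !rmorph0 horner0 subrr valuation0 leey.
have [N HN] := scale_continuous u a M; have [q Nq] := IHp N.
have [x Mx] := completion_dense fP c M.
exists (q * 'X + x%:P); rewrite !rmorphD !rmorphM /= !map_polyX !map_polyC /=.
rewrite !hornerMXaddC opprD addrACA -mulrBl valuation_geD ?HN //.
by rewrite valuation_distC -rmorphB gP.
Qed.

(** [a] may be algebraic over [G] and transcendental over [F]; approximating
the coefficients of numerators and denominators still does not move values. *)
Lemma value_group_adjoin_completion (a : E) :
  value_group u (adjoin_field (g \o f) a) = value_group u (adjoin_field g a).
Proof.
have approx (p : {poly G}) : (map_poly g p).[a] != 0 ->
    exists q : {poly F}, u (map_poly (g \o f) q).[a] = u (map_poly g p).[a].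
  move=> p0; have [M HM] := valuation_locally_constant u p0.
  by have [q Mq] := horner_dense p a M; exists q; exact: HM.
apply/seteqP; split=> r [_ [p [q [/eqP q0 ->]]] pqr].
  rewrite !map_poly_comp in q0 pqr; eexists; last exact: pqr.
  by exists (map_poly f p), (map_poly f q); split=> //; exact/eqP.
have := valuation_fin_neq0 pqr; rewrite mulf_eq0 invr_eq0 (negPf q0) orbF => p0.
have [p' p'E] := approx _ p0; have [q' q'E] := approx _ q0.
have [t qt] := valuation_fin u q0; rewrite qt in q'E.
exists ((map_poly (g \o f) p').[a] / (map_poly (g \o f) q').[a]).
  by exists p', q'; split=> //; apply/eqP; exact: valuation_fin_neq0 q'E.
by rewrite -pqr !valuationM p'E (valuationV q'E) (valuationV qt).
Qed.

End Density.

(** * The valuation of F(X) induced by a transcendental element *)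

Section RationalFunctions.

Variables (F G : fieldType) (f : {rmorphism F -> G}) (a : G).
Hypothesis a_transc : ~ algebraicOver f a.

Implicit Types (phi psi : {fraction {poly F}}) (p q : {poly F}).
Local Notation "p %:Fr" := (FracField.tofrac p) (at level 2).

Lemma horner_transc_eq0 p : ((map_poly f p).[a] == 0) = (p == 0).
Proof.
apply/idP/eqP => [pa|->]; last by rewrite rmorph0 horner0.
by apply/eqP/negPn/negP => p0; apply: a_transc; exists p.
Qed.

Lemma fraction_repr phi : phi * (\d_(repr phi))%:Fr = (\n_(repr phi))%:Fr.
Proof.
have d0 := denom_ratioP (repr phi).
rewrite -{1}[phi]reprK; unlock FracField.tofrac.
rewrite -[LHS]FracField.pi_mul; apply/eqmodP; rewrite /= FracField.equivfE.
rewrite /FracField.mulf !numden_Ratio ?mulf_neq0 ?oner_neq0 //.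
by rewrite !mulr1 mulrC.
Qed.

(** Evaluation is defined through a chosen representative; transcendence of
[a] makes the value independent of it, which yields the morphism laws. *)
Lemma ratfun_eval_quotient phi p q : q != 0 -> phi * q%:Fr = p%:Fr ->
  ratfun_eval f a phi = (map_poly f p).[a] / (map_poly f q).[a].
Proof.
move=> q0 phiE; have d0 := denom_ratioP (repr phi).
rewrite /ratfun_eval; set d := \d_(repr phi) in d0 *; set n := \n_(repr phi).
have : n * q = p * d.
  apply/eqP; rewrite -tofrac_eq !tofracM -fraction_repr -phiE.
  by rewrite mulrAC.
move=> /(congr1 (fun r => (map_poly f r).[a])); rewrite !rmorphM !hornerM /= => E.
by apply/eqP; rewrite eqr_div ?horner_transc_eq0 // E.
Qed.

Lemma ratfun_eval_frac p q : q != 0 ->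
  ratfun_eval f a (p%:Fr / q%:Fr) = (map_poly f p).[a] / (map_poly f q).[a].
Proof.
by move=> q0; apply: ratfun_eval_quotient; rewrite // divfK // tofrac_eq0.
Qed.

Lemma fractionP phi : exists p q, q != 0 /\ phi = p%:Fr / q%:Fr.
Proof.
exists \n_(repr phi), \d_(repr phi); split; first exact: denom_ratioP.
by rewrite -fraction_repr mulfK // tofrac_eq0 denom_ratioP.
Qed.

Lemma ratfun_evalM phi psi :
  ratfun_eval f a (phi * psi) = ratfun_eval f a phi * ratfun_eval f a psi.
Proof.
have [p [q [q0 ->]]] := fractionP phi; have [r [s [s0 ->]]] := fractionP psi.
rewrite mulf_div -!tofracM !ratfun_eval_frac ?mulf_neq0 //.
by rewrite !rmorphM !hornerM /= mulf_div.
Qed.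

Lemma ratfun_evalD phi psi :
  ratfun_eval f a (phi + psi) = ratfun_eval f a phi + ratfun_eval f a psi.
Proof.
have [p [q [q0 ->]]] := fractionP phi; have [r [s [s0 ->]]] := fractionP psi.
rewrite addf_div ?tofrac_eq0 // -!tofracM -tofracD.
rewrite !ratfun_eval_frac ?mulf_neq0 //.
by rewrite rmorphD !rmorphM hornerD !hornerM addf_div ?horner_transc_eq0.
Qed.

Lemma ratfun_eval_eq0 phi : (ratfun_eval f a phi == 0) = (phi == 0).
Proof.
have [p [q [q0 ->]]] := fractionP phi; rewrite ratfun_eval_frac //.
by rewrite !mulf_eq0 !invr_eq0 !tofrac_eq0 !horner_transc_eq0.
Qed.

Variable w : valuation G rat.

Definition valuation_at_fun phi := w (ratfun_eval f a phi).

Lemma valuation_at_neqNy phi : valuation_at_fun phi <> -oo%E.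
Proof. exact: valuation_neqNy. Qed.

Lemma valuation_at_eqy phi : valuation_at_fun phi = +oo%E <-> phi = 0.
Proof.
split=> [/valuation_eqy/eqP|->]; first by rewrite ratfun_eval_eq0 => /eqP.
by apply/valuation_eqy/eqP; rewrite ratfun_eval_eq0.
Qed.

Lemma valuation_atM phi psi : valuation_at_fun (phi * psi) =
  (valuation_at_fun phi + valuation_at_fun psi)%E.
Proof. by rewrite /valuation_at_fun ratfun_evalM valuationM. Qed.

Lemma valuation_atD phi psi :
  (mine (valuation_at_fun phi) (valuation_at_fun psi)
     <= valuation_at_fun (phi + psi)%R)%E.
Proof. by rewrite /valuation_at_fun ratfun_evalD valuationD. Qed.

Definition valuation_at : valuation {fraction {poly F}} rat :=
  Valuation valuation_at_neqNy valuation_at_eqy valuation_atM valuation_atD.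

Lemma value_group_at :
  value_group valuation_at setT = value_group w (adjoin_field f a).
Proof.
apply/seteqP; split=> r.
  move=> [phi _]; have [p [q [q0 ->]]] := fractionP phi.
  rewrite /= /valuation_at_fun ratfun_eval_frac // => pqr.
  eexists; last exact: pqr.
  by exists p, q; split=> //; apply/eqP; rewrite horner_transc_eq0.
move=> [_ [p [q [/eqP q0 ->]]] pqr].
exists (p%:Fr / q%:Fr) => //=.
by rewrite /valuation_at_fun ratfun_eval_frac // -horner_transc_eq0.
Qed.

End RationalFunctions.

(** * Minimal pairs *)

Section MinimalPairs.

Variables (F : fieldType) (C : closedFieldType) (G : fieldType).
Variables (j : {rmorphism F -> C}) (l : {rmorphism C -> G}).
Variable (w : valuation G rat).
Hypothesis j_alg : forall x : C, algebraicOver j x.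

(** Over an algebraically closed field the value of a polynomial is read off
from the distances to its roots. *)
Lemma valuation_horner_split (p : {poly F}) (x y : G) :
  (forall z, root (map_poly j p) z -> w (x - l z) = w (y - l z)) ->
  w (map_poly (l \o j) p).[x] = w (map_poly (l \o j) p).[y].
Proof.
rewrite !map_poly_comp.
have [r ->] := closed_field_poly_normal (map_poly j p).
set c := lead_coef _; have [->|c0] := eqVneq c 0.
  by rewrite scale0r rmorph0 !horner0.
move=> xy; rewrite -mul_polyC rmorphM /= map_polyC !hornerM !hornerC.
rewrite !valuationM; congr (_ + _)%E.
have {}xy z : z \in r -> w (x - l z) = w (y - l z).
  by move=> zr; apply: xy; rewrite rootZ // root_prod_XsubC.
elim: r xy => [|z r IHr] xy; first by rewrite big_nil rmorph1 !hornerC.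
rewrite big_cons rmorphM /= map_polyXsubC !hornerM !valuationM !hornerXsubC.
rewrite xy ?mem_head // IHr // => t tr.
by apply: xy; rewrite in_cons tr orbT.
Qed.

(** Minimality of the degree of [s] keeps the roots of polynomials of smaller
degree farther from [a] than [s] is, so such polynomials cannot distinguish
[s] from [a]; reduction modulo an annihilator of [s] brings every element of
[F(s)] down to such polynomials. *)
Lemma minimal_pair (a : G) (M : rat) :
  (exists s, (M%:E <= w (l s - a)%R)%E) ->
  exists2 s, (M%:E <= w (l s - a)%R)%E &
    value_group w (adjoin_field (l \o j) (l s)) `<=`
    value_group w (adjoin_field (l \o j) a).
Proof.
move=> [s0 Ms0].
pose annihilates (p : {poly F}) s :=
  [/\ p != 0, root (map_poly j p) s & (M%:E <= w (l s - a)%R)%E].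
have exP : exists n, `[< exists p s, annihilates p s /\ size p = n >].
  have [p p0 ps] := j_alg s0.
  by exists (size p); apply/asboolP; exists p, s0.
case: (ex_minnP exP) => _ /asboolP[m [s [[m0 ms Ms] <-]]] m_min.
exists s => //.
have low_deg (p : {poly F}) : p != 0 -> (size p < size m)%N ->
    w (map_poly (l \o j) p).[l s] = w (map_poly (l \o j) p).[a].
  move=> p0 pm; apply: valuation_horner_split => z pz.
  have z_far : (w (l z - a)%R < M%:E)%E.
    rewrite ltNge; apply/negP => Mz; move: pm; rewrite ltnNge.
    by rewrite m_min //; apply/asboolP; exists p, z.
  rewrite ![w (_ - l z)]valuation_distC; apply: valuation_eq_dist.
  have -> : l z - l s - (l z - a) = a - l s by ring.
  rewrite [ltRHS]valuation_distC.
  exact: lt_le_trans z_far Ms.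
have modE (p : {poly F}) : (map_poly (l \o j) p).[l s]
    = (map_poly (l \o j) (p %% m)).[l s].
  rewrite [p in LHS](divp_eq p m) rmorphD rmorphM hornerD hornerM /=.
  rewrite [map_poly _ m]map_poly_comp horner_map (rootP ms) rmorph0.
  by rewrite mulr0 add0r.
have modN0 (p : {poly F}) : (map_poly (l \o j) p).[l s] != 0 ->
    w (map_poly (l \o j) p).[l s] = w (map_poly (l \o j) (p %% m)).[a].
  rewrite modE => p0; apply: low_deg; last by rewrite ltn_modp.
  by apply: contraNneq p0 => ->; rewrite rmorph0 horner0.
move=> r [_ [p [q [/eqP q0 ->]]] pqr].
have := valuation_fin_neq0 pqr; rewrite mulf_eq0 invr_eq0 (negPf q0) orbF => p0.
have [t qt] := valuation_fin w q0; have q't := modN0 q q0; rewrite qt in q't.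
have q'0 := valuation_fin_neq0 (esym q't).
eexists; first by exists (p %% m), (q %% m); split; [exact/eqP|].
by rewrite -pqr !valuationM (modN0 p) // (valuationV qt) (valuationV (esym q't)).
Qed.

End MinimalPairs.

(** * The equivalence *)

Theorem proposition5p5
  (K : fieldType) (v : valuation K rat) (V_DVR : is_DVR (valuation_ring v))
  (Khat : fieldType) (vhat : valuation Khat rat)
  (i : {rmorphism K -> Khat}) (Khat_completion : is_completion i v vhat)
  (Kbar : closedFieldType) (vbar : valuation Kbar rat)
  (j : {rmorphism Khat -> Kbar})
  (Kbar_algebraic : forall x : Kbar, algebraicOver j x)
  (vbar_extends : extends j vhat vbar)
  (KK : fieldType) (vK : valuation KK rat)
  (l : {rmorphism Kbar -> KK}) (KK_completion : is_completion l vbar vK)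
  (alpha : KK) (alpha_transcendental : ~ algebraicOver (l \o j \o i) alpha) :
  let e : KK -> \bar int := ramification_index (l \o j) vK in
  let cond1 : Prop := (e alpha < +oo)%E in
  let cond2 : Prop := is_DVR (valuation_ring_at (l \o j \o i) vK alpha) in
  let cond3 : Prop := exists s : nat -> Kbar,
    [/\ cauchy_for vbar s, converges_for vK (l \o s) alpha
      & exists B : nat, forall n : nat, (e (l (s n)) <= (Posz B)%:E)%E] in
  ((forall (k : fieldType) (res : K -> k),
      is_residue_map v res -> perfect_field k ->
      (cond1 <-> cond2) /\ (cond2 <-> cond3))
   /\ (cond3 -> cond2)).
Proof.
move=> e cond1 cond2 cond3.
have vK_extends : extends (l \o j) vhat vK.
  by move=> x /=; rewrite (completion_extends KK_completion) vbar_extends.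
have [c c_gt0 Hc] := DVR_value_group V_DVR.
have base : value_group vK (range (l \o j)) = multiples c.
  rewrite -Hc -(completion_value_group Khat_completion).
  apply/seteqP; split=> r; last first.
    by move=> [x _ xr]; exists ((l \o j) x); [exists x|rewrite vK_extends].
  by move=> [_ [x _ <-] xr]; exists x => //; rewrite -vK_extends.
pose H s := value_group vK (adjoin_field (l \o j) s).
have eE s : e s = group_index (H s) (multiples c).
  by rewrite /e /ramification_index base.
have Hmuln s g n : H s g -> H s (g *+ n).
  move=> [_ [p [q [q0 ->]]] pqg]; eexists; last exact: valuationX n pqg.
  exists (p ^+ n), (q ^+ n); rewrite !rmorphXn !horner_exp expr_div_n.
  by split=> //; apply/eqP; rewrite expf_neq0 //; exact/eqP.
have e_torsion s B g : (e s <= (Posz B)%:E)%E -> H s g ->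
    exists2 m, (0 < m <= B)%N & multiples c (g *+ m).
  rewrite eE => eB Hg; apply: group_index_torsion eB.
  - by exists 0; rewrite ?mulr0z.
  - exact: multiplesB.
  - by move=> n; exact: Hmuln.
pose valpha := valuation_at alpha_transcendental vK.
have Halpha : value_group valpha setT = H alpha.
  by rewrite value_group_at (value_group_adjoin_completion Khat_completion).
have HalphaB r s : H alpha r -> H alpha s -> H alpha (r - s).
  by rewrite -Halpha; exact: value_groupB.
have Halpha_c : H alpha c.
  have [_ [x _ <-] xc] : value_group vK (range (l \o j)) c.
    by rewrite base; exists 1 => //; rewrite mulr1z.
  exists ((l \o j) x) => //; exists x%:P, 1.
  rewrite rmorph1 hornerC divr1 map_polyC hornerC; split=> //.
  exact/eqP/oner_neq0.
(* Both cond1 and cond3 imply cond2 through this bound on the torsion of [H alpha]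
   modulo the value group of the base field. *)
have torsion_cond2 B : (forall g, H alpha g ->
    exists2 m, (0 < m <= B)%N & multiples c (g *+ m)) -> cond2.
  move=> Htors; have [c' c'0 Hc'] :=
    bounded_torsion_multiples c_gt0 HalphaB Halpha_c Htors.
  by apply: (@value_group_DVR _ valpha c' c'0); rewrite Halpha.
have cond2_discrete : cond2 -> exists d n,
    [/\ (0 < n)%N, c = d *+ n & H alpha = multiples d].
  move=> dvr; have [d d0 Hd] := @DVR_value_group _ _ valpha dvr.
  rewrite Halpha in Hd; have [z _ cE] : multiples d c by rewrite -Hd.
  have z0 : 0 < z by rewrite -(ltr_pMz2l d0) mulr0z cE.
  case: z z0 cE => // n n0 cE.
  by exists d, n.
have cond31 : cond3 -> cond2.
  move=> [s [_ s_cvg [B eB]]]; apply: (torsion_cond2 B) => g.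
  move=> [_ [p [q [/eqP q0 ->]]] pqg].
  have := valuation_fin_neq0 pqg.
  rewrite mulf_eq0 invr_eq0 (negPf q0) orbF => p0.
  have near_alpha (r : {poly Khat}) : (map_poly (l \o j) r).[alpha] != 0 ->
      exists N, forall n, (N <= n)%N -> vK (map_poly (l \o j) r).[l (s n)]
        = vK (map_poly (l \o j) r).[alpha].
    move=> r0; have [M HM] := valuation_locally_constant vK r0.
    have [M' HM'] := horner_continuous vK (map_poly (l \o j) r) alpha M.
    have [N HN] := s_cvg M'; exists N => n /HN Nn.
    by apply: HM; exact: HM'.
  have [Np HNp] := near_alpha _ p0; have [Nq HNq] := near_alpha _ q0.
  set n := maxn Np Nq; apply: (e_torsion (l (s n)) B) (eB n) _.
  have [t qt] := valuation_fin vK q0.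
  have qt' := HNq n (leq_maxr _ _); rewrite qt in qt'.
  exists ((map_poly (l \o j) p).[l (s n)] / (map_poly (l \o j) q).[l (s n)]).
    by exists p, q; split=> //; apply/eqP; exact: valuation_fin_neq0 qt'.
  by rewrite -pqg !valuationM HNp ?leq_maxl // (valuationV qt) (valuationV qt').
split=> // k res _ _; split; split=> //.
- move=> /group_index_fin[B eB]; apply: (torsion_cond2 B) => g.
  exact: e_torsion.
- move=> /cond2_discrete[d [n [n0 cE HE]]]; rewrite /cond1 eE HE cE.
  apply: le_lt_trans (group_index_multiples n0 (@subset_refl _ _)) _.
  by rewrite ltey.
move=> /cond2_discrete[d [n [n0 cE HE]]].
have approx m : exists s, (m%:R%:E <= vK (l s - alpha)%R)%E /\
    H (l s) `<=` H alpha.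
  have [|s Ms Hs] := @minimal_pair _ _ _ j l vK Kbar_algebraic alpha m%:R.
    have [s Ms] := completion_dense KK_completion alpha m%:R.
    by exists s; rewrite valuation_distC.
  by exists s.
have [s sP] := choice approx.
have s_cvg : converges_for vK (l \o s) alpha.
  (* [vK (l (s m) - alpha)] is at least [m], hence at least [M] once [m] exceeds
     the absolute value of [M]. *)
  move=> M; exists (Num.truncn `|M|).+1 => m le_m.
  apply: le_trans (proj1 (sP m)); rewrite lee_fin.
  apply: le_trans (ler_norm M) _; apply: ltW.
  by apply: lt_le_trans (truncnS_gt _) _; rewrite ler_nat.
exists s; split=> //.
  move=> M; have [N HN] := s_cvg M; exists N => m p le_m le_p.
  rewrite -(completion_extends KK_completion) rmorphB.
  have -> : l (s m) - l (s p) = (l (s m) - alpha) - (l (s p) - alpha) by ring.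
  by apply: valuation_geB; exact: HN.
exists n => m; rewrite eE cE; apply: group_index_multiples => //.
by rewrite -HE; exact: (proj2 (sP m)).
Qed.
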